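(* Let $\mathbf{L}$ be an irreducible graph link with $r$ components, exterior $X$, and graph with $p$ nodes $v_{r+1},\dots,v_{r+p}$. For $i=1,\dots,p$, the characteristic hyperplane $\mathcal{H}_i$ of $\mathbf{L}$ is the set $\mathcal{H}_i=\{\phi\in H^1(X;\mathbb{R})\mid\|\phi\|_T^i=0\}$, where $\|\phi\|_T^i$ is the contribution of the $i$-th splice component to the Thurston norm.
   Context: A Seifert link is a link in a homology 3-sphere with Seifert-fibered exterior; every one is of the form $(\Sigma(\epsilon;\alpha_1,\dots,\alpha_n),S_1\cup\dots\cup S_s)$, where $\Sigma(\epsilon;\alpha_1,\dots,\alpha_n)$ is the Seifert-fibered homology 3-sphere with fibers of pairwise coprime multiplicities $\alpha_i$ and orientation $\epsilon=\pm1$, and $S_1,\dots,S_s$ are the first $s$ of the corresponding fibers. Its graph is a node of sign $\epsilon$ with $n\ge3$ edges weighted $\alpha_1,\dots,\alpha_n$, ending in arrowhead vertices for $S_1,\dots,S_s$ and in boundary vertices for the other fibers. Splicing two links along a component of each (remove open tubular neighborhoods and glue the boundary tori interchanging meridian and longitude) corresponds to joining the two arrowhead edges into one edge (keeping one weight at each end). A graph link is a Seifert link or a splice of two or more Seifert links in homology 3-spheres; it is irreducible if it is not a disjoint sum of links. Its graph is the minimal splice diagram, with nonnegative edge weights, boundary vertex edge weights at least $2$, and at least three edges at each node; it has $r$ arrowheads $v_1,\dots,v_r$ and $p$ nodes $v_{r+1},\dots,v_{r+p}$ (besides boundary vertices). The linking number $l_{ij}$ of distinct vertices is the product of the signs of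 all nodes on the simple path $\sigma_{ij}$ from $v_i$ to $v_j$ (endpoints included) times the product of all edge weights adjacent to these nodes but not on $\sigma_{ij}$. With coordinates $\phi_j$ = value of $\phi$ on the meridian of the $j$-th component, the characteristic hyperplane of the $i$-th node is $\mathcal{H}_i=\{\phi\in H^1(X;\mathbb{R})\mid\sum_{j=1}^r\phi_j l_{j,r+i}=0\}$. The contribution of the $i$-th splice component to the Thurston norm $\|\phi\|_T=\sum_{i=1}^p\|\phi\|_T^i$ is $\|\phi\|_T^i=(\tilde\delta_{r+i}-2)\,\big|\sum_{j=1}^r\phi_j l_{j,r+i}\big|$, where for a node $v_m$, $\tilde\delta_m=\delta_m-\sum_k\frac1{\alpha_k^m}$, with $\delta_m$ the number of edges at $v_m$ and $\alpha_k^m$ the weights at $v_m$ of the edges to the boundary vertices attached to $v_m$. *)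

(* Defs.v *)
From HB Require Import structures.
From mathcomp Require Import all_boot all_order all_algebra.
From mathcomp Require Import all_classical all_reals.
Set Implicit Arguments.
Unset Strict Implicit.
Unset Printing Implicit Defensive.
Import Order.TTheory GRing.Theory Num.Theory.
Local Open Scope classical_set_scope.
Local Open Scope ring_scope.

(** A graph link is represented by its splice diagram, with [r] arrowheads
    (the link components), [p] nodes (the splice components) and [b] boundary
    vertices. *)

Definition vertex (r p b : nat) : finType := ('I_r + 'I_p + 'I_b)%type.

Section Vertices.
Variables r p b : nat.
Definition arrowhead (j : 'I_r) : vertex r p b := inl (inl j).
Definition node (m : 'I_p) : vertex r p b := inl (inr m).
Definition boundary (k : 'I_b) : vertex r p b := inr k.
End Vertices.
Arguments arrowhead {r p b} j.
Arguments node {r p b} m.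
Arguments boundary {r p b} k.

(** [wt m v] is the weight, at the end adjacent to [node m], of the edge from
    [node m] to [v]; it is only meaningful when this edge exists.  An edge
    between two nodes thus carries two weights, and an edge has no weight at
    an arrowhead or boundary end.

    [wt_coprime] says that the star of each node is the graph of a Seifert link
    in the homology sphere Sigma(sgn m; weights at m); a weight is 0 only if
    the other weights at the node are 1 or -1.  The edges joining nodes record
    the splicings, which never create a cycle. *)
Record splice_diagram (r p b : nat) := SpliceDiagram {
  adj : rel (vertex r p b);
  sgn : 'I_p -> int;
  wt : 'I_p -> vertex r p b -> int;
  adj_sym : symmetric adj;
  adj_irr : irreflexive adj;
  adj_acyclic : forall c : seq (vertex r p b),
    ucycle adj c -> (size c <= 2)%N;
  arrowhead_leaf : forall j : 'I_r, #|adj (arrowhead j)| = 1%N;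
  boundary_leaf : forall k : 'I_b, #|adj (boundary k)| = 1%N;
  sgn_unit : forall m, sgn m = 1 \/ sgn m = -1;
  wt_coprime : forall (m : 'I_p) (u v : vertex r p b),
    adj (node m) u -> adj (node m) v -> u != v -> coprimez (wt m u) (wt m v)
}.

Section SpliceDiagram.
Variables (r p b : nat) (L : splice_diagram r p b).
Implicit Types (x y u v : vertex r p b) (m : 'I_p).

Definition degree m : nat := #|adj L (node m)|.

(** The splice diagram of a disjoint sum of two links is the disjoint union of
    their diagrams. *)
Definition disjoint_sum : Prop :=
  exists A : {set vertex r p b},
    [/\ exists x, x \in A, exists y, y \notin A
      & forall x y, x \in A -> y \notin A -> ~~ adj L x y].

Definition irreducible_link : Prop := ~ disjoint_sum.

(** The last clause says that no two adjacent nodes can be merged into one: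
    on the torus separating the two Seifert pieces, the fibers have slopes
    [a_0 : sgn m * a] and [sgn m' * a' : a_0'], where [a_0], [a_0'] are the
    weights on the joining edge and [a], [a'] the products of the other weights
    at [m], [m'].  They agree if and only if
    [a_0 * a_0' = sgn m * sgn m' * a * a']. *)
Definition minimal_diagram : Prop :=
  [/\ forall m v, adj L (node m) v -> 0 <= wt L m v,
      forall m (k : 'I_b), adj L (node m) (boundary k) ->
        2 <= wt L m (boundary k),
      forall m, (3 <= degree m)%N
    & forall m m', adj L (node m) (node m') ->
        wt L m (node m') * wt L m' (node m) !=
        sgn L m * sgn L m'
        * \prod_(v | adj L (node m) v && (v != node m')) wt L m v
        * \prod_(v | adj L (node m') v && (v != node m)) wt L m' v].

(** The sequence of vertices, [x] and [y] included, of the simple path from [x]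
    to [y]; it is unique since the diagram has no cycle. *)
Definition simple_path x y : seq (vertex r p b) :=
  x :: xget [::] [set s | [/\ path (adj L) x s, last x s = y & uniq (x :: s)]].

Definition edge_on (s : seq (vertex r p b)) u v : bool :=
  ((u, v) \in zip s (behead s)) || ((v, u) \in zip s (behead s)).

(** Meant for distinct [x] and [y]; components of the diagram that are not
    connected to each other are unlinked. *)
Definition linking_number x y : int :=
  if connect (adj L) x y then
    let s := simple_path x y in
    (\prod_(m : 'I_p | node m \in s) sgn L m)
    * \prod_(m : 'I_p | node m \in s)
        \prod_(v | adj L (node m) v && ~~ edge_on s (node m) v) wt L m v
  else 0.

End SpliceDiagram.

(** The first homology group of the exterior of a link in a homology sphere is
    free on the meridians, so its first real cohomology group is identified
    with R^r; the [j]-th coordinate of a class is its value on the meridian of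
    the [j]-th component. *)
Definition H1 (R : realType) (r : nat) := 'rV[R]_r.

Section Norm.
Variables (R : realType) (r p b : nat) (L : splice_diagram r p b).
Implicit Types (phi : H1 R r) (i m : 'I_p).

(** The value of [phi] on the generic fiber of the [i]-th splice component. *)
Definition fiber_value i phi : R :=
  \sum_(j < r) phi 0 j * (linking_number L (arrowhead j) (node i))%:~R.

Definition characteristic_hyperplane i : set (H1 R r) :=
  [set phi | fiber_value i phi = 0].

Definition reduced_degree m : R :=
  (degree L m)%:R
  - \sum_(k < b | adj L (node m) (boundary k)) (wt L m (boundary k))%:~R^-1.

Definition thurston_norm_contribution i phi : R :=
  (reduced_degree i - 2) * `|fiber_value i phi|.

End Norm.

(* Main.v *)
Require Import Defs.
From mathcomp Require Import all_boot all_order all_algebra.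
From mathcomp Require Import all_classical all_reals.
From mathcomp Require Import zify lra.
Import Order.TTheory GRing.Theory Num.Theory.
Local Open Scope classical_set_scope.
Local Open Scope ring_scope.

(** The two zero sets can differ only if the coefficient [reduced_degree L i - 2]
    vanishes, so it suffices that this coefficient is positive as soon as the
    link has a component; for the empty link both sets are everything, the
    fiber value being an empty sum.

    Let [d] be the number of edges from the node to arrowheads and other nodes,
    and let [B] be the set of its boundary vertices, with weights [a_k].  The
    coefficient is [d - 2 + \sum_(k in B) (1 - 1 / a_k)].  Every term of the sum
    is at least [1 / 2], because boundary weights are at least 2, and two terms
    cannot both equal [1 / 2], because the weights at a node are pairwise coprime
    ([sum_inv_coprime_lt]).  Moreover [d >= 1]: if all neighbors of the node were
    boundary vertices, the node would split off with them from the arrowheads,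
    and the link would be a disjoint sum ([inner_neighbors_gt0]).  Since
    [d + #|B| >= 3], the coefficient is positive in each of the cases [d = 1],
    [d = 2] and [d >= 3].  For [d = 0] it can be negative: the weights 2, 3, 5 of
    the Poincare sphere give [- 1 / 30]. *)

(** Pairwise coprimality lets at most one [a k] equal 2, so that as soon as [A]
    has two elements the termwise bound [1 / 2] is strict somewhere. *)
Lemma sum_inv_coprime_lt (F : realFieldType) (I : finType) (A : {set I})
    (a : I -> int) :
  {in A, forall k, 2 <= a k} ->
  {in A &, forall k l, k != l -> coprimez (a k) (a l)} ->
  (1 < #|A|)%N -> \sum_(k in A) (a k)%:~R^-1 < #|A|%:R / 2 :> F.
Proof.
move=> a_ge2 a_coprime /card_gt1P[k [l [kA lA kl]]].
have inv_le c x : 0 < c -> c <= a x -> (a x)%:~R^-1 <= (c%:~R^-1 : F).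
  by move=> c0 cx; rewrite lef_pV2 ?ler_int // posrE ltr0z // (lt_le_trans c0).
have [m mA am] : exists2 m, m \in A & 3 <= a m.
  have [ak|ak] := eqVneq (a k) 2; last by exists k; have := a_ge2 _ kA; lia.
  have [al|al] := eqVneq (a l) 2; last by exists l; have := a_ge2 _ lA; lia.
  by have := a_coprime _ _ kA lA kl; rewrite ak al.
rewrite -sum1_card natr_sum mulr_suml (bigD1 m) //= [ltRHS](bigD1 m) //=.
apply: ltr_leD; first by have := inv_le 3 m isT am; lra.
apply: ler_sum => x /andP[xA _].
by have := inv_le 2 x isT (a_ge2 _ xA); rewrite mul1r.
Qed.

Section Node.
Variables (r p b : nat) (L : splice_diagram r p b) (i : 'I_p).

Definition boundary_neighbors : {set 'I_b} :=
  [set k | adj L (node i) (boundary k)]%SET.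

Definition inner_neighbors : {set 'I_r + 'I_p} :=
  [set v | adj L (node i) (inl v)]%SET.

Lemma degree_inner_boundary :
  degree L i = (#|inner_neighbors| + #|boundary_neighbors|)%N.
Proof.
rewrite /degree -!sum1_card big_sumType /=.
by congr addn; apply: eq_bigl => v; rewrite inE.
Qed.

Lemma boundary_neighbor_unique (k : 'I_b) (x y : vertex r p b) :
  adj L (boundary k) x -> adj L (boundary k) y -> x = y.
Proof.
move=> kx ky; have /mem_card1[z adj_k] := boundary_leaf L k.
by move/(_ x): (adj_k) (adj_k y); rewrite !inE -!topredE /= kx ky
  => /esym/eqP-> /esym/eqP->.
Qed.

(** Otherwise the node and its neighbors, which are then leaves, form a union
    of components of the diagram, and this union does not contain the
    arrowhead. *)
Lemma inner_neighbors_gt0 :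
  irreducible_link L -> (0 < r)%N -> (0 < #|inner_neighbors|)%N.
Proof.
move=> irr r_gt0; rewrite lt0n; apply/negP => /eqP/cards0_eq inner0.
have inner v : adj L (node i) (inl v) = false.
  by have /setP/(_ v) := inner0; rewrite !inE.
apply: irr; exists [set x | (x == node i) || adj L (node i) x]%SET; split.
- by exists (node i); rewrite inE eqxx.
- by exists (arrowhead (Ordinal r_gt0)); rewrite inE inner.
move=> x y; rewrite !inE negb_or => /orP[/eqP->|ix] /andP[yi iy] //.
apply/negP => xy; case: x ix xy => [v|k]; first by rewrite inner.
rewrite adj_sym => ki ky.
by move: yi; rewrite (boundary_neighbor_unique _ _ _ ky ki) eqxx.
Qed.

(** With at most one boundary vertex, [d >= 2] and the crude bound [1 / 2] on the
    inverse weights leaves room.  With two or more, [d = 1] is possible and the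
    crude bound only gives [>= 2]; coprimality makes it strict. *)
Lemma reduced_degree_gt2 (R : realType) :
  irreducible_link L -> minimal_diagram L -> (0 < r)%N ->
  2 < reduced_degree R L i.
Proof.
move=> irr [_ wt_ge2 deg_ge3 _] r_gt0.
have d_gt0 := inner_neighbors_gt0 irr r_gt0.
have := deg_ge3 i.
rewrite /reduced_degree degree_inner_boundary natrD.
rewrite (eq_bigl (mem boundary_neighbors)) => [|k]; last by rewrite /= inE.
set S := \sum_(k | _) _; set d := #|inner_neighbors| in d_gt0 *.
have wtB : {in boundary_neighbors, forall k, 2 <= wt L i (boundary k)}.
  by move=> k; rewrite inE; exact: wt_ge2.
have [B_le1|B_gt1] := leqP #|boundary_neighbors| 1 => dB.
  have S_le : S <= #|boundary_neighbors|%:R / 2.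
    rewrite -sum1_card natr_sum mulr_suml; apply: ler_sum => k /wtB wk.
    by rewrite mul1r lef_pV2 ?(ler_int _ 2) // posrE ?ltr0z //
      (lt_le_trans _ wk).
  have : 3 <= d%:R + #|boundary_neighbors|%:R :> R by rewrite -natrD ler_nat.
  have : #|boundary_neighbors|%:R <= 1 :> R by rewrite lern1.
  lra.
have S_lt : S < #|boundary_neighbors|%:R / 2.
  apply: sum_inv_coprime_lt => // k l; rewrite !inE => ik il kl.
  by apply: wt_coprime.
have : 3 <= d%:R + #|boundary_neighbors|%:R :> R by rewrite -natrD ler_nat.
have : 1 <= d%:R :> R by rewrite ler1n.
lra.
Qed.

End Node.

Theorem corollary7p16 (R : realType) (r p b : nat) (L : splice_diagram r p b)
    (L_irreducible : irreducible_link L) (L_minimal : minimal_diagram L)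
    (i : 'I_p) :
  @characteristic_hyperplane R r p b L i =
  [set phi : H1 R r | thurston_norm_contribution L i phi = 0].
Proof.
apply/seteqP; split => phi; rewrite /characteristic_hyperplane
  /thurston_norm_contribution /=; first by move=> ->; rewrite normr0 mulr0.
have [r0 _|r_gt0] := posnP r.
  by rewrite /fiber_value big1 // => j; have := ltn_ord j; rewrite {2}r0.
have coef_gt0 := reduced_degree_gt2 _ _ _ L i R L_irreducible L_minimal r_gt0.
by move/eqP; rewrite mulf_eq0 normr_eq0 subr_eq0 gt_eqF //= => /eqP.
Qed.
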